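(* Let $(P,<_1,<_2)$ be the random permutation. The automorphism group $\operatorname{Aut}(P,<_1,<_2)$ has no mixed identities (in any finite number $r$ of variables).
   Context: The random permutation $(P,<_1,<_2)$ is the (up to isomorphism unique) countable homogeneous structure equipped with two linear orders $<_1,<_2$ such that every finite set equipped with two linear orders is isomorphic to an induced substructure of $(P,<_1,<_2)$. Homogeneous means that every isomorphism between finite induced substructures extends to an automorphism; automorphisms preserve both orders. For a group $G$ and the free group $\mathbf F_r=\langle x_1,\dots,x_r\rangle$, a word with constants in $G$ is an element $w\in G\ast\mathbf F_r$. For $g_1,\dots,g_r\in G$, $w(g_1,\dots,g_r)\in G$ denotes the image of $w$ under the homomorphism $G\ast\mathbf F_r\to G$ that is the identity on $G$ and sends $x_i\mapsto g_i$. The word $w$ is a mixed identity for $G$ if $w\neq1$ in $G\ast\mathbf F_r$ and $w(g_1,\dots,g_r)=1_G$ for all $g_1,\dots,g_r\in G$. *)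

(* Defs.v *)
From HB Require Import structures.
From mathcomp Require Import all_boot.
From mathcomp Require Import generic_quotient boolp classical_sets functions.
From mathcomp Require Import cardinality.

Set Implicit Arguments.
Unset Strict Implicit.
Unset Printing Implicit Defensive.

Local Open Scope quotient_scope.
Local Open Scope group_scope.

Inductive word_congr (S : Type) (R : seq S -> seq S -> Prop) :
    seq S -> seq S -> Prop :=
| WordRefl s : word_congr R s s
| WordSym s t : word_congr R s t -> word_congr R t s
| WordTrans s t u : word_congr R s t -> word_congr R t u -> word_congr R s u
| WordStep u v s t : R s t -> word_congr R (u ++ s ++ v) (u ++ t ++ v).

Definition word_inv (S : Type) (i : S -> S) (s : seq S) := rev (map i s).

(* The last three fields make the monoid of words modulo [word_congr letter_rel]
   a group, with inverse induced by [word_inv letter_inv]. *)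
Record presentation := Presentation {
  letter : choiceType;
  letter_inv : letter -> letter;
  letter_rel : seq letter -> seq letter -> Prop;
  letter_invK : involutive letter_inv;
  letter_inv_rel : forall s t, letter_rel s t ->
    word_congr letter_rel (word_inv letter_inv s) (word_inv letter_inv t);
  letter_invl : forall a, word_congr letter_rel [:: letter_inv a; a] [::] }.

Section PresentedGroup.
Variable p : presentation.
Local Notation W := (seq (letter p)).
Local Notation congr := (word_congr (@letter_rel p)).
Local Notation winv := (word_inv (@letter_inv p)).

Definition congrb (s t : W) : bool := `[< congr s t >].

Lemma congrb_refl : reflexive congrb.
Proof. by move=> s; apply/asboolP; constructor. Qed.

Lemma congrb_sym : symmetric congrb.
Proof. by move=> s t; apply/asboolP/asboolP; exact: WordSym. Qed.

Lemma congrb_trans : transitive congrb.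
Proof.
by move=> t s u /asboolP st /asboolP tu; apply/asboolP; exact: WordTrans st tu.
Qed.

Canonical congrb_equiv := EquivRel congrb congrb_refl congrb_sym congrb_trans.

Lemma word_congr_ctx u v s t : congr s t -> congr (u ++ s ++ v) (u ++ t ++ v).
Proof.
elim=> [a|a b _|a b c _ IH1 _|u' v' a b Rab].
- exact: WordRefl.
- exact: WordSym.
- exact: WordTrans.
- by rewrite -!catA !(catA u); exact: WordStep.
Qed.

Lemma word_congr_cat s s' t t' :
  congr s s' -> congr t t' -> congr (s ++ t) (s' ++ t').
Proof.
move=> ss tt; apply: (@WordTrans _ _ _ (s' ++ t)).
  exact: (word_congr_ctx [::] t ss).
by have := @word_congr_ctx s' [::] _ _ tt; rewrite !cats0.
Qed.

Lemma word_inv_cat (s t : W) : winv (s ++ t) = winv t ++ winv s.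
Proof. by rewrite /word_inv map_cat rev_cat. Qed.

Lemma word_congr_inv s t : congr s t -> congr (winv s) (winv t).
Proof.
elim=> [a|a b _|a b c _ IH1 _|u v a b Rab].
- exact: WordRefl.
- exact: WordSym.
- exact: WordTrans.
- rewrite !word_inv_cat -!catA; apply: word_congr_ctx.
  exact: letter_inv_rel.
Qed.

Lemma word_congr_invl s : congr (winv s ++ s) [::].
Proof.
elim: s => [|a s IH]; first exact: WordRefl.
rewrite -cat1s word_inv_cat -catA (catA _ [:: a]).
apply: WordTrans IH.
exact: (word_congr_ctx (winv s) s (letter_invl a)).
Qed.

Definition presented_group := {eq_quot congrb_equiv}.

HB.instance Definition _ := Choice.on presented_group.

Definition pword (s : W) : presented_group := \pi_({eq_quot congrb_equiv})%qT s.

Lemma pword_eq s t : pword s = pword t <-> congr s t.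
Proof.
split=> [/eqP|st]; last by apply/eqmodP/asboolP.
by move/eqP/eqmodP/asboolP.
Qed.

Lemma pwordK (x : presented_group) : pword (repr x) = x.
Proof. exact: reprK. Qed.

Definition pg_one := pword [::].
Definition pg_mul (x y : presented_group) := pword (repr x ++ repr y).
Definition pg_inv (x : presented_group) := pword (winv (repr x)).

Lemma repr_pword s : congr (repr (pword s)) s.
Proof. by apply/pword_eq; rewrite pwordK. Qed.

Lemma pg_mulE s t : pg_mul (pword s) (pword t) = pword (s ++ t).
Proof. by apply/pword_eq; apply: word_congr_cat; exact: repr_pword. Qed.

Lemma pg_invE s : pg_inv (pword s) = pword (winv s).
Proof. by apply/pword_eq; apply: word_congr_inv; exact: repr_pword. Qed.

Lemma pg_mulA : associative pg_mul.
Proof.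
by move=> x y z; rewrite -(pwordK x) -(pwordK y) -(pwordK z) !pg_mulE catA.
Qed.

Lemma pg_mul1 : left_id pg_one pg_mul.
Proof. by move=> x; rewrite -(pwordK x) pg_mulE. Qed.

Lemma pg_mulg1 : right_id pg_one pg_mul.
Proof. by move=> x; rewrite -(pwordK x) pg_mulE cats0. Qed.

Lemma pg_mulV : left_inverse pg_one pg_inv pg_mul.
Proof.
move=> x; rewrite -(pwordK x) pg_invE pg_mulE.
by apply/pword_eq; exact: word_congr_invl.
Qed.

Lemma pg_mulgV : right_inverse pg_one pg_inv pg_mul.
Proof.
move=> x; rewrite -[in X in pg_mul X _](pwordK x) /pg_inv pg_mulE.
apply/pword_eq.
have := word_congr_invl (winv (repr x)).
rewrite {1}/word_inv map_rev revK -map_comp.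
by rewrite (eq_map (@letter_invK p)) map_id.
Qed.

HB.instance Definition _ := isGroup.Build presented_group
  pg_mulA pg_mul1 pg_mulg1 pg_mulV pg_mulgV.

Lemma pwordM s t : pword (s ++ t) = pword s * pword t.
Proof. by rewrite -pg_mulE. Qed.

Section Lift.
Variables (G : groupType) (f : letter p -> G).

Definition pg_lift (x : presented_group) : G := \prod_(a <- repr x) f a.

Hypothesis fR : forall s t, @letter_rel p s t ->
  \prod_(a <- s) f a = \prod_(a <- t) f a.

Lemma pg_liftE s : pg_lift (pword s) = \prod_(a <- s) f a.
Proof.
have prod_congr t u : congr t u -> \prod_(a <- t) f a = \prod_(a <- u) f a.
  elim=> [//|a b _ -> //|a b c _ -> _ -> //|u' v' a b /fR].
  by rewrite !big_cat /= => ->.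
exact: prod_congr (repr_pword s).
Qed.

Lemma pg_lift_morphism : monoid_morphism pg_lift.
Proof.
split=> [|x y]; first by rewrite -[1]/(pword [::]) pg_liftE big_nil.
by rewrite -(pwordK x) -(pwordK y) -pwordM !pg_liftE big_cat.
Qed.

End Lift.
End PresentedGroup.

Section FreeGroup.
Variable X : choiceType.

(* [(x, false)] is the letter x and [(x, true)] the letter x^-1. *)
Definition free_letter_inv (a : X * bool) := (a.1, ~~ a.2).

Inductive free_rel : seq (X * bool) -> seq (X * bool) -> Prop :=
| FreeCancel a : free_rel [:: free_letter_inv a; a] [::].

Lemma free_letter_invK : involutive free_letter_inv.
Proof. by case=> x b; rewrite /free_letter_inv /= negbK. Qed.

Lemma free_letter_invl a : word_congr free_rel [:: free_letter_inv a; a] [::].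
Proof. exact: (@WordStep _ _ [::] [::] _ _ (FreeCancel a)). Qed.

Lemma free_letter_inv_rel s t : free_rel s t ->
  word_congr free_rel (word_inv free_letter_inv s) (word_inv free_letter_inv t).
Proof.
case=> a; rewrite /word_inv /= /rev /= free_letter_invK.
exact: free_letter_invl.
Qed.

Definition free_presentation :=
  Presentation free_letter_invK free_letter_inv_rel free_letter_invl.

Definition free_group := presented_group free_presentation.

HB.instance Definition _ := Group.on free_group.

Definition free_gen (x : X) : free_group :=
  @pword free_presentation [:: (x, false)].

Section Lift.
Variables (G : groupType) (g : X -> G).

Definition free_letter_val (a : X * bool) : G :=
  if a.2 then (g a.1)^-1 else g a.1.

Definition free_lift (x : free_group) : G :=
  @pg_lift free_presentation G free_letter_val x.

Lemma free_letter_val_rel s t : free_rel s t ->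
  \prod_(a <- s) free_letter_val a = \prod_(a <- t) free_letter_val a.
Proof.
case=> -[x b]; rewrite !big_cons !big_nil mulg1 /free_letter_val /=.
by case: b; rewrite /= ?mulVg ?mulgV.
Qed.

Lemma free_lift_morphism : monoid_morphism free_lift.
Proof. exact: (@pg_lift_morphism free_presentation _ _ free_letter_val_rel). Qed.

HB.instance Definition _ :=
  isUMagmaMorphism.Build free_group G free_lift free_lift_morphism.

Lemma free_lift_gen x : free_lift (free_gen x) = g x.
Proof.
rewrite /free_lift (@pg_liftE free_presentation _ _ free_letter_val_rel).
by rewrite big_seq1.
Qed.

End Lift.
End FreeGroup.

Section FreeProduct.
Variables A B : groupType.

Definition prod_letter_inv (l : A + B) : A + B :=
  match l with inl a => inl a^-1 | inr b => inr b^-1 end.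

Inductive free_prod_rel : seq (A + B) -> seq (A + B) -> Prop :=
| ProdOneL : free_prod_rel [:: inl 1] [::]
| ProdOneR : free_prod_rel [:: inr 1] [::]
| ProdMulL a a' : free_prod_rel [:: inl a; inl a'] [:: inl (a * a')]
| ProdMulR b b' : free_prod_rel [:: inr b; inr b'] [:: inr (b * b')].

Lemma prod_letter_invK : involutive prod_letter_inv.
Proof. by case=> a /=; rewrite invgK. Qed.

Lemma free_prod_rel_congr s t : free_prod_rel s t -> word_congr free_prod_rel s t.
Proof.
by move=> st; have := @WordStep _ _ [::] [::] _ _ st; rewrite /= !cats0.
Qed.

Lemma prod_letter_invl l :
  word_congr free_prod_rel [:: prod_letter_inv l; l] [::].
Proof.
case: l => a /=; apply: WordTrans (free_prod_rel_congr _).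
- by apply: free_prod_rel_congr; exact: ProdMulL.
- by rewrite mulVg; exact: ProdOneL.
- by apply: free_prod_rel_congr; exact: ProdMulR.
- by rewrite mulVg; exact: ProdOneR.
Qed.

Lemma prod_letter_inv_rel s t : free_prod_rel s t ->
  word_congr free_prod_rel
    (word_inv prod_letter_inv s) (word_inv prod_letter_inv t).
Proof.
case=> [||a a'|b b']; rewrite /word_inv /rev /= ?invg1 ?invgM;
  apply: free_prod_rel_congr; by constructor.
Qed.

Definition free_prod_presentation :=
  Presentation prod_letter_invK prod_letter_inv_rel prod_letter_invl.

Definition free_product := presented_group free_prod_presentation.

HB.instance Definition _ := Group.on free_product.

Definition free_inl (a : A) : free_product :=
  @pword free_prod_presentation [:: inl a].
Definition free_inr (b : B) : free_product :=
  @pword free_prod_presentation [:: inr b].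

Section Lift.
Variables (G : groupType).
Variables (f : UMagmaMorphism.type A G).
Variables (h : UMagmaMorphism.type B G).

Definition prod_letter_val (l : A + B) : G :=
  match l with inl a => f a | inr b => h b end.

Definition free_prod_lift (x : free_product) : G :=
  @pg_lift free_prod_presentation G prod_letter_val x.

Lemma prod_letter_val_rel s t : free_prod_rel s t ->
  \prod_(l <- s) prod_letter_val l = \prod_(l <- t) prod_letter_val l.
Proof.
case=> [||a a'|b b']; rewrite !big_cons !big_nil ?mulg1 /=.
- exact: gmulf1.
- exact: gmulf1.
- by rewrite gmulfM.
- by rewrite gmulfM.
Qed.

Lemma free_prod_lift_morphism : monoid_morphism free_prod_lift.
Proof.
exact: (@pg_lift_morphism free_prod_presentation _ _ prod_letter_val_rel).
Qed.

HB.instance Definition _ :=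
  isUMagmaMorphism.Build free_product G free_prod_lift free_prod_lift_morphism.

Lemma free_prod_lift_inl a : free_prod_lift (free_inl a) = f a.
Proof.
rewrite /free_prod_lift.
by rewrite (@pg_liftE free_prod_presentation _ _ prod_letter_val_rel) big_seq1.
Qed.

Lemma free_prod_lift_inr b : free_prod_lift (free_inr b) = h b.
Proof.
rewrite /free_prod_lift.
by rewrite (@pg_liftE free_prod_presentation _ _ prod_letter_val_rel) big_seq1.
Qed.

End Lift.
End FreeProduct.

Section MixedIdentity.
Variables (G : groupType) (r : nat).

Definition const_word := free_product G (free_group 'I_r).

HB.instance Definition _ := Group.on const_word.

(* The homomorphism that is the identity on G and sends x_i to g i. *)
Definition word_eval (g : 'I_r -> G) (w : const_word) : G :=
  free_prod_lift (@idfun G) (free_lift g) w.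

Lemma word_eval_morphism g : monoid_morphism (word_eval g).
Proof. exact: free_prod_lift_morphism. Qed.

Lemma word_eval_const g c : word_eval g (free_inl _ c) = c.
Proof. exact: free_prod_lift_inl. Qed.

Lemma word_eval_var g i : word_eval g (free_inr _ (free_gen i)) = g i.
Proof. by rewrite /word_eval free_prod_lift_inr /= free_lift_gen. Qed.

Definition mixed_identity (w : const_word) : Prop :=
  w <> 1 /\ forall g : 'I_r -> G, word_eval g w = 1.

End MixedIdentity.

Definition strict_linear_order (T : eqType) (lt : rel T) : Prop :=
  [/\ irreflexive lt, transitive lt &
      forall x y, x != y -> lt x y || lt y x].

Section TwoOrders.
Variables (P : countType) (lt1 lt2 : rel P).

(* The inverse is stored as data; it is determined by [aut_fun]. *)
Record two_order_aut := TwoOrderAut {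
  aut_fun :> P -> P;
  aut_inv : P -> P;
  aut_funK : cancel aut_fun aut_inv;
  aut_invK : cancel aut_inv aut_fun;
  aut_mono1 : {mono aut_fun : x y / lt1 x y};
  aut_mono2 : {mono aut_fun : x y / lt2 x y} }.

HB.instance Definition _ := gen_eqMixin two_order_aut.
HB.instance Definition _ := gen_choiceMixin two_order_aut.

Lemma two_order_autP (a b : two_order_aut) : a =1 b -> a = b.
Proof.
case: a b => [f f' fK f'K f1 f2] [h h' hK h'K h1 h2] /= /funext fh.
subst h.
have E : f' = h' by apply/funext => x; rewrite -{1}(h'K x) fK.
by subst h'; congr TwoOrderAut; exact: Prop_irrelevance.
Qed.

Definition aut_one : two_order_aut.
Proof. by exists id id. Defined.

Definition aut_mul (a b : two_order_aut) : two_order_aut.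
Proof.
exists (a \o b) (aut_inv b \o aut_inv a).
- by move=> x /=; rewrite !aut_funK.
- by move=> x /=; rewrite !aut_invK.
- by move=> x y /=; rewrite !aut_mono1.
- by move=> x y /=; rewrite !aut_mono2.
Defined.

Definition aut_opp (a : two_order_aut) : two_order_aut.
Proof.
exists (aut_inv a) a.
- exact: aut_invK.
- exact: aut_funK.
- by move=> x y; rewrite -(aut_mono1 a) !aut_invK.
- by move=> x y; rewrite -(aut_mono2 a) !aut_invK.
Defined.

Lemma aut_mulA : associative aut_mul.
Proof. by move=> a b c; apply: two_order_autP. Qed.

Lemma aut_mul1 : left_id aut_one aut_mul.
Proof. by move=> a; apply: two_order_autP. Qed.

Lemma aut_mulg1 : right_id aut_one aut_mul.
Proof. by move=> a; apply: two_order_autP. Qed.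

Lemma aut_mulV : left_inverse aut_one aut_opp aut_mul.
Proof. by move=> a; apply: two_order_autP => x /=; rewrite aut_funK. Qed.

Lemma aut_mulgV : right_inverse aut_one aut_opp aut_mul.
Proof. by move=> a; apply: two_order_autP => x /=; rewrite aut_invK. Qed.

HB.instance Definition _ := isGroup.Build two_order_aut
  aut_mulA aut_mul1 aut_mulg1 aut_mulV aut_mulgV.

(* The values of [f] outside [A] are irrelevant. *)
Definition substructure_iso (A B : set P) (f : P -> P) : Prop :=
  set_bij A B f /\
  forall x y, A x -> A y ->
    lt1 (f x) (f y) = lt1 x y /\ lt2 (f x) (f y) = lt2 x y.

Definition homogeneous : Prop :=
  forall (A B : set P) (f : P -> P), finite_set A -> finite_set B ->
    substructure_iso A B f ->
    exists a : two_order_aut, forall x, A x -> a x = f x.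

Definition universal : Prop :=
  forall (T : finType) (l1 l2 : rel T),
    strict_linear_order l1 -> strict_linear_order l2 ->
    exists f : T -> P,
      [/\ injective f, {mono f : x y / l1 x y >-> lt1 x y} &
          {mono f : x y / l2 x y >-> lt2 x y}].

Definition random_permutation : Prop :=
  [/\ strict_linear_order lt1, strict_linear_order lt2,
      homogeneous & universal].

End TwoOrders.

(* Main.v *)
(** A nontrivial automorphism c moves a point in every pair of cuts, one in each
   order, of a finite set: between z and c z in one order lie points with any
   prescribed cut in the other order, and such points close to z are moved.
   Hence, given a word with constants in reduced form, one can follow a point
   along it while building the substituted automorphisms as finite partial
   isomorphisms: at each letter the point goes to a fresh point which the next
   constant moves to another fresh point, so the letters never conflict and the
   trajectory does not return to its origin. *)

Require Import Defs.
From mathcomp Require Import all_boot.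
From mathcomp Require Import boolp classical_sets functions cardinality.

Set Implicit Arguments.
Unset Strict Implicit.
Unset Printing Implicit Defensive.

Local Open Scope group_scope.

(** * Strict linear orders and their initial segments *)

Section LinearOrder.
Variables (T : eqType) (lt : rel T).
Hypothesis ltP : strict_linear_order lt.

Lemma slo_irr x : lt x x = false.
Proof. by case: ltP => irr _ _; exact: irr. Qed.

Lemma slo_trans x y z : lt x y -> lt y z -> lt x z.
Proof. by case: ltP => _ tr _; exact: tr. Qed.

Lemma slo_total x y : x != y -> lt x y || lt y x.
Proof. by case: ltP => _ _; apply. Qed.

Lemma slo_flip x y : x != y -> lt y x = ~~ lt x y.
Proof.
move=> /slo_total; case xy: (lt x y) => //= _.
by apply/negP => /(slo_trans xy); rewrite slo_irr.
Qed.

Definition down_closed (D : pred T) := forall x y, lt x y -> D y -> D x.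

Lemma down_closed_lt z : down_closed (lt^~ z).
Proof. by move=> x y; exact: slo_trans. Qed.

Lemma down_closed_le z : down_closed (fun x => (x == z) || lt x z).
Proof.
move=> x y xy /orP[/eqP <-|yz]; first by rewrite xy orbT.
by rewrite (slo_trans xy yz) orbT.
Qed.

End LinearOrder.

(** * Cuts of finite sets, and moved points inside them *)

Section Cut.
Variables (T : choiceType) (lt : rel T) (D : pred T) (s : seq T).
Hypothesis ltP : strict_linear_order lt.
Hypothesis Ddown : down_closed lt D.

(** [None] is a new point adjoined to [s], above the part of [s] inside [D] and below the rest. *)
Definition cut_rel (u v : option (seq_sub s)) : bool :=
  match u, v with
  | Some x, Some y => lt (val x) (val y)
  | Some x, None => D (val x)
  | None, Some y => ~~ D (val y)
  | None, None => false
  end.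

Lemma cut_rel_slo : strict_linear_order cut_rel.
Proof.
split=> [[x|] //=|[y|] [x|] [z|] //=|[x|] [y|] //=].
- exact: slo_irr.
- exact: slo_trans.
- exact: Ddown.
- by move=> Dy yz; apply: contra Dy; exact: Ddown.
- by move=> Dy; rewrite (negbTE Dy).
- move=> Dx Dz; have [xz|xz] := eqVneq (val x) (val z).
    by rewrite xz (negbTE Dz) in Dx.
  rewrite (slo_flip ltP) 1?eq_sym //.
  by apply: contra Dz => zx; exact: Ddown zx Dx.
- by move=> xy; apply: slo_total.
- by rewrite orbN.
- by rewrite orNb.
Qed.

End Cut.

(* Cuts of the finite set s are given by down-closed predicates of the whole
   type, so that they also cut any larger finite set. *)
Definition realizes_cuts (P : eqType) (l1 l2 : rel P) :=
  forall (s : seq P) (D1 D2 : pred P), down_closed l1 D1 -> down_closed l2 D2 ->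
  exists2 q, q \notin s & forall x, x \in s -> l1 x q = D1 x /\ l2 x q = D2 x.

Lemma realizes_cutsC (P : eqType) (l1 l2 : rel P) :
  realizes_cuts l1 l2 -> realizes_cuts l2 l1.
Proof.
move=> rc s D2 D1 d2 d1; have [q qs cut] := rc s D1 D2 d1 d2.
by exists q => // x /cut[-> ->].
Qed.

(** Take [q] strictly between [z] and [c z] for [l1], with no point of [s] between [q] and [z]. If
    [c] fixed [q], monotonicity would put [z] and [c z] on the same side of [q]. *)
Lemma moved_point_in_cut (P : eqType) (l1 l2 : rel P) (c : P -> P) z
    (s : seq P) (D2 : pred P) :
  strict_linear_order l1 -> realizes_cuts l1 l2 ->
  {mono c : x y / l1 x y} -> c z != z -> down_closed l2 D2 ->
  exists q, [/\ q \notin s, c q != q &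
    forall x, x \in s -> (x != z -> l1 x q = l1 x z) /\ l2 x q = D2 x].
Proof.
move=> l1P rc cmono cz d2.
have [mz mcz] : z \in [:: z, c z & s] /\ c z \in [:: z, c z & s].
  by rewrite !inE !eqxx orbT.
case/orP: (slo_total l1P cz) => lz.
- have [q] := rc [:: z, c z & s] _ _ (down_closed_lt l1P (z := z)) d2.
  rewrite !inE !negb_or => /and3P[qz qcz qs] cut; exists q; split=> //.
    have [czq _] := cut _ mcz; have [zq _] := cut _ mz.
    rewrite /= slo_irr // in zq; rewrite /= lz in czq.
    have qz' : l1 q z by rewrite (slo_flip l1P) ?zq 1?eq_sym.
    apply/eqP => cq; have := cmono q z; rewrite cq qz' => qcz'.
    by have := slo_trans l1P czq qcz'; rewrite slo_irr.
  by move=> x xs; have [|-> ->//] := cut x; rewrite !inE xs !orbT.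
(* Here [z] lies below [c z], so the cut includes [z] and [q] falls just above it. *)
- have [q] := rc [:: z, c z & s] _ _ (down_closed_le l1P (z := z)) d2.
  rewrite !inE !negb_or => /and3P[qz qcz qs] cut; exists q; split=> //.
    have [czq _] := cut _ mcz; have [zq _] := cut _ mz.
    rewrite /= (negbTE cz) (slo_flip l1P (x := z)) 1?eq_sym // lz /= in czq.
    rewrite /= eqxx in zq.
    by apply/eqP => cq; have := cmono z q; rewrite cq czq zq.
  move=> x xs; have [|-> ->] := cut x; first by rewrite !inE xs !orbT.
  by split=> // /negbTE ->.
Qed.

(** * Finite partial isomorphisms of the random permutation *)

Section RandomPermutation.
Variables (P : countType) (lt1 lt2 : rel P).
Hypothesis hP : random_permutation lt1 lt2.

Local Notation aut := (two_order_aut lt1 lt2).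

Lemma rp_slo1 : strict_linear_order lt1. Proof. by case: hP. Qed.
Lemma rp_slo2 : strict_linear_order lt2. Proof. by case: hP. Qed.

Definition partial_iso (s : seq (P * P)) := forall e e', e \in s -> e' \in s ->
  lt1 e.1 e'.1 = lt1 e.2 e'.2 /\ lt2 e.1 e'.1 = lt2 e.2 e'.2.

(** Distinct points are comparable for [lt1], so order preservation makes the list of pairs the
    graph of an injective function. *)
Lemma partial_iso_inj s e e' : partial_iso s -> e \in s -> e' \in s ->
  (e.1 == e'.1) = (e.2 == e'.2).
Proof.
move=> iso es e's.
have [lt_ee' _] := iso _ _ es e's; have [lt_e'e _] := iso _ _ e's es.
apply/eqP/eqP => E; apply/eqP; apply/negPn/negP => /(slo_total rp_slo1).
  by rewrite -lt_ee' -lt_e'e E (slo_irr rp_slo1).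
by rewrite lt_ee' lt_e'e E (slo_irr rp_slo1).
Qed.

Lemma partial_iso_extends s : partial_iso s ->
  exists g : aut, forall e, e \in s -> g e.1 = e.2.
Proof.
move=> iso.
(* Homogeneity takes a total function, so the graph is extended arbitrarily off its domain. *)
have [a|h hE] := @choice _ _ (fun a c => forall b, (a, b) \in s -> c = b).
  have [[b ab]|nab] := pselect (exists b, (a, b) \in s); last first.
    by exists a => b ab; case: nab; exists b.
  exists b => b' ab'; apply/eqP.
  by rewrite -(partial_iso_inj iso ab ab').
have [_ _ hom _] := hP.
pose A := [set` map fst s]%classic.
have memA a : A a -> exists2 b, (a, b) \in s & h a = b.
  by move=> /mapP[[a' b] ab ->]; exists b => //; exact: hE.
have [g gE] : exists g : aut, forall x, A x -> g x = h x.
  apply: (hom A (h @` A)%classic); first exact: finite_seq.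
    by apply: finite_image; exact: finite_seq.
  split; last first.
    move=> x y /memA[b xb ->] /memA[b' yb' ->].
    by have [-> ->] := iso _ _ xb yb'.
  apply/inj_bij => x y /set_mem/memA[b xb ->] /set_mem/memA[b' yb' ->] bb'.
  by apply/eqP; rewrite (partial_iso_inj iso xb yb') bb'.
exists g => -[a b] ab; rewrite gE /=; first exact: hE.
by apply/mapP; exists (a, b).
Qed.

(** Universality embeds the one-point extension of [s] given by both cuts; an automorphism carrying
    the copy of [s] back onto [s] takes the new point to the desired one. *)
Lemma rp_realizes_cuts : realizes_cuts lt1 lt2.
Proof.
move=> s D1 D2 d1 d2; have [_ _ _ univ] := hP.
have [f [finj f1 f2]] :=
  univ _ _ _ (cut_rel_slo s rp_slo1 d1) (cut_rel_slo s rp_slo2 d2).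
have [_ _ /mapP[x _ ->] /mapP[y _ ->]|g gE] :=
  @partial_iso_extends [seq (f (Some x), val x) | x <- enum {: seq_sub s}].
  by rewrite /= f1 f2.
have gS x (xs : x \in s) : g (f (Some (SeqSub xs))) = x.
  by apply: (gE (_, _)); apply/mapP; exists (SeqSub xs); rewrite ?mem_enum.
exists (g (f None)).
  by apply/negP => qs; have := gS _ qs => /(can_inj (aut_funK g)) /finj.
by move=> x xs; rewrite -{1 3}(gS x xs) aut_mono1 aut_mono2 f1 f2.
Qed.

Lemma aut_neq1_moves (c : aut) : c != 1 -> exists z, c z != z.
Proof.
move=> c1; apply: contrapT => nz; case/eqP: c1; apply: two_order_autP => x.
by apply/eqP/negPn/negP => cx; apply: nz; exists x.
Qed.

(** For nontrivial [c], a moved point [z] is first found in the cut [D1] of [lt1], close to some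
    moved point for [lt2]. Then [q] is taken close to [z] for [lt1], hence still in [D1], and in the
    cut [D2] of [lt2]. *)
Lemma rp_moved_point (c : aut) (s : seq P) (D1 D2 : pred P) :
  down_closed lt1 D1 -> down_closed lt2 D2 ->
  exists q, [/\ q \notin s, c q \notin s, c != 1 -> c q != q &
    forall x, x \in s -> lt1 x q = D1 x /\ lt2 x q = D2 x].
Proof.
(* With the preimages under [c] added, avoiding [s'] keeps both [q] and [c q] out of [s]. *)
move=> d1 d2; pose s' := s ++ map (aut_inv c) s.
have avoid q : q \notin s' -> q \notin s /\ c q \notin s.
  rewrite mem_cat negb_or => /andP[-> qs]; split=> //; apply: contra qs => cqs.
  by apply/mapP; exists (c q); rewrite ?aut_funK.
suff [q [/avoid[qs cqs] cq cut]] : exists q, [/\ q \notin s', c != 1 -> c q != q &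
    forall x, x \in s' -> lt1 x q = D1 x /\ lt2 x q = D2 x].
  by exists q; split=> // x xs; apply: cut; rewrite mem_cat xs.
have [->|/aut_neq1_moves[z0 cz0]] := eqVneq c 1.
  by have [q qs cut] := rp_realizes_cuts s' d1 d2; exists q.
have [z [zs cz cutz]] := moved_point_in_cut s' rp_slo2
  (realizes_cutsC rp_realizes_cuts) (aut_mono2 c) cz0 d1.
have [q [qs cq cut]] :=
  moved_point_in_cut s' rp_slo1 rp_realizes_cuts (aut_mono1 c) cz d2.
exists q; split=> // x xs; have [lt1xq ->] := cut x xs.
rewrite lt1xq; last by apply: contraNneq zs => <-.
by have [_ ->] := cutz x xs.
Qed.

Lemma partial_iso_step s p (c : aut) (t : seq P) :
  partial_iso s -> p \notin map fst s ->
  exists q, [/\ q \notin t, c q \notin t, c != 1 -> c q != q &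
    partial_iso ((p, q) :: s)].
Proof.
move=> iso ps.
(* The initial segment generated by the images of the points below [p]: the cut that the image of
   [p] has to fill. *)
pose D (lt : rel P) y :=
  has (fun e => lt e.1 p && ((y == e.2) || lt y e.2)) s.
have D_down lt : strict_linear_order lt -> down_closed lt (D lt).
  move=> ltP x y xy /hasP[e es /andP[ep ye]]; apply/hasP; exists e => //.
  by rewrite ep; exact: (down_closed_le ltP xy ye).
have DE lt e : strict_linear_order lt ->
    (forall e e', e \in s -> e' \in s -> lt e.1 e'.1 = lt e.2 e'.2) ->
    e \in s -> D lt e.2 = lt e.1 p.
  move=> ltP ltE es; apply/hasP/idP => [[e' e's /andP[e'p]]|ep]; last first.
    by exists e => //; rewrite ep eqxx.
  rewrite -(partial_iso_inj iso es e's) -ltE // => /orP[/eqP ->//|ee'].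
  exact: slo_trans ee' e'p.
(* Avoiding the range of [s] as well makes [q] comparable with every image. *)
have [q [qt cqt cq cut]] := rp_moved_point c (t ++ map snd s)
  (D_down _ rp_slo1) (D_down _ rp_slo2).
rewrite mem_cat negb_or in cqt; have /andP[{}cqt _] := cqt.
rewrite mem_cat negb_or in qt; have /andP[{}qt qs] := qt.
exists q; split=> //.
have below e : e \in s -> lt1 e.1 p = lt1 e.2 q /\ lt2 e.1 p = lt2 e.2 q.
  move=> es; have [|-> ->] := cut e.2; first by rewrite mem_cat map_f ?orbT.
  by rewrite !DE //; try exact: rp_slo1; try exact: rp_slo2;
    move=> a b /iso ia /ia[].
have above e : e \in s -> lt1 p e.1 = lt1 q e.2 /\ lt2 p e.1 = lt2 q e.2.
  move=> es; have [b1 b2] := below e es.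
  have ep : e.1 != p by apply: contraNneq ps => <-; exact: map_f.
  have eq : e.2 != q by apply: contraNneq qs => <-; exact: map_f.
  by rewrite !(slo_flip rp_slo1 ep, slo_flip rp_slo1 eq,
               slo_flip rp_slo2 ep, slo_flip rp_slo2 eq) b1 b2.
move=> e e'; rewrite !inE => /orP[/eqP ->|es] /orP[/eqP ->|e's].
- by rewrite /= !(slo_irr rp_slo1) !(slo_irr rp_slo2).
- exact: above.
- exact: below.
- exact: iso.
Qed.

End RandomPermutation.

(** * Reduced forms of words with constants *)

Section ReducedWords.
Variables (G : groupType) (r : nat).
Local Notation cword := (const_word G r).
Local Notation sgn := ('I_r * bool)%type.

Lemma free_inl1 : free_inl (free_group 'I_r) (1 : G) = 1 :> cword.
Proof. by apply/pword_eq; exact/free_prod_rel_congr/ProdOneL. Qed.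

Lemma free_inlM (a b : G) :
  free_inl (free_group 'I_r) (a * b) = free_inl _ a * free_inl _ b :> cword.
Proof.
rewrite -pwordM; apply/esym/pword_eq.
exact/free_prod_rel_congr/ProdMulL.
Qed.

Lemma free_inr1 : free_inr G (1 : free_group 'I_r) = 1 :> cword.
Proof. by apply/pword_eq; exact/free_prod_rel_congr/ProdOneR. Qed.

Lemma free_inrM (a b : free_group 'I_r) :
  free_inr G (a * b) = free_inr _ a * free_inr _ b :> cword.
Proof.
rewrite -pwordM; apply/esym/pword_eq.
exact/free_prod_rel_congr/ProdMulR.
Qed.

Definition letter_word (v : sgn) : cword :=
  free_inr G (@pword (free_presentation 'I_r) [:: v]).

Lemma letter_wordK v : letter_word (free_letter_inv v) * letter_word v = 1.
Proof.
rewrite -free_inrM -free_inr1; congr free_inr.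
rewrite -pwordM; apply/pword_eq; exact: free_letter_invl.
Qed.

(* The list [:: (v1, c1); ...; (vn, cn)] stands for cn vn ... c1 v1, in the order
   in which the factors act on a point. *)
Fixpoint syllables_word (l : seq (sgn * G)) : cword :=
  if l is a :: l' then
    syllables_word l' * free_inl _ a.2 * letter_word a.1
  else 1.

(** The constant between the letters of consecutive entries [a], [b] is [a.2]; what is excluded is a
    letter meeting its inverse across a trivial constant. *)
Definition reduced : pred (seq (sgn * G)) :=
  sorted (fun a b => (b.1 != free_letter_inv a.1) || (a.2 != 1)).

Definition has_reduced_form (w : cword) := exists l c,
  reduced l /\ w = syllables_word l * free_inl _ c.

Lemma has_reduced_form_mulr_const w c :
  has_reduced_form w -> has_reduced_form (w * free_inl _ c).
Proof.
by move=> [l [d [redl ->]]]; exists l, (d * c); rewrite free_inlM mulgA.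
Qed.

(** The letter becomes the new head and takes over the trailing constant, unless it cancels with the
    old head, whose constant then becomes the trailing one. *)
Lemma has_reduced_form_mulr_letter w v :
  has_reduced_form w -> has_reduced_form (w * letter_word v).
Proof.
move=> [[|[u d] l] [c [redl ->]]].
  by exists [:: (v, c)], 1; rewrite /= free_inl1 mulg1.
case: (boolP ((u != free_letter_inv v) || (c != 1))) => uv.
  exists [:: (v, c), (u, d) & l], 1; split; last by rewrite free_inl1 mulg1.
  by rewrite /reduced /= uv.
move: uv; rewrite negb_or !negbK => /andP[/eqP uE /eqP cE].
exists l, d; split; first exact: path_sorted redl.
by rewrite /= uE cE free_inl1 mulg1 -mulgA letter_wordK mulg1.
Qed.

Lemma has_reduced_form_mulr_free w u :
  has_reduced_form w -> has_reduced_form (w * free_inr _ u).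
Proof.
rewrite -(pwordK u); elim: (repr u) w => [|v t IH] w redw.
  by rewrite free_inr1 mulg1.
rewrite -cat1s pwordM free_inrM mulgA.
by apply: IH; exact: has_reduced_form_mulr_letter.
Qed.

Lemma reduced_form w : has_reduced_form w.
Proof.
(* The leading 1 becomes an accumulator, multiplied on the right by one factor at a time. *)
rewrite -[w]mul1g -(pwordK w).
have : has_reduced_form 1 by exists [::], 1; rewrite free_inl1 mulg1.
elim: (repr w) (1 : cword) => [|a s IH] u redu.
  by rewrite -[pword _]/(1 : cword) mulg1.
rewrite -cat1s pwordM mulgA; apply: IH; case: a => [c|x].
  exact: has_reduced_form_mulr_const.
exact: has_reduced_form_mulr_free.
Qed.

Variable g : 'I_r -> G.

Lemma word_evalM (u v : cword) :
  word_eval g (u * v) = word_eval g u * word_eval g v.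
Proof. exact: (word_eval_morphism g).2. Qed.

Lemma word_eval_letter v : word_eval g (letter_word v) = free_letter_val g v.
Proof.
rewrite /word_eval free_prod_lift_inr /= /free_lift.
by rewrite (@pg_liftE (free_presentation _) _ _ (free_letter_val_rel g)) big_seq1.
Qed.

Lemma word_eval_syllables a l : word_eval g (syllables_word (a :: l)) =
  word_eval g (syllables_word l) * a.2 * free_letter_val g a.1.
Proof. by rewrite /= !word_evalM word_eval_const word_eval_letter. Qed.

End ReducedWords.

(** * Building a substitution along the trajectory of a point *)

Section FollowWord.
Variables (P : countType) (lt1 lt2 : rel P) (r : nat).
Hypothesis hP : random_permutation lt1 lt2.
Local Notation aut := (two_order_aut lt1 lt2).
Local Notation sgn := ('I_r * bool)%type.

(* [(v, (p, q)) \in E] demands that the letter v sends p to q, hence also that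
   its inverse sends q to p. *)
Definition demands (E : seq (sgn * (P * P))) (v : sgn) : seq (P * P) :=
  [seq e.2 | e <- E & e.1 == v] ++
  [seq (e.2.2, e.2.1) | e <- E & e.1 == free_letter_inv v].

Lemma mem_demands E v a b : ((a, b) \in demands E v) =
  ((v, (a, b)) \in E) || ((free_letter_inv v, (b, a)) \in E).
Proof.
rewrite mem_cat; congr orb; apply/mapP/idP.
- by case=> -[u e]; rewrite mem_filter /= => /andP[/eqP -> ?] ->.
- by move=> E'; exists (v, (a, b)); rewrite ?mem_filter ?eqxx.
- by case=> -[u [x y]]; rewrite mem_filter /= => /andP[/eqP -> ?] [-> ->].
- by move=> E'; exists (free_letter_inv v, (b, a)); rewrite ?mem_filter ?eqxx.
Qed.

Lemma demands_inv E v a b :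
  ((a, b) \in demands E (free_letter_inv v)) = ((b, a) \in demands E v).
Proof. by rewrite !mem_demands free_letter_invK orbC. Qed.

Lemma free_letter_inv_neq v : (v == free_letter_inv v :> sgn) = false.
Proof. by case: v => i []; rewrite xpair_eqE /= andbF. Qed.

Lemma demands_cons E v p q : demands ((v, (p, q)) :: E) v = (p, q) :: demands E v.
Proof. by rewrite /demands /= eqxx free_letter_inv_neq. Qed.

Lemma demands_cons_inv E v p q a b :
  ((a, b) \in demands ((v, (p, q)) :: E) (free_letter_inv v)) =
  ((a, b) == (q, p)) || ((a, b) \in demands E (free_letter_inv v)).
Proof. by rewrite !demands_inv demands_cons inE !xpair_eqE andbC. Qed.

Lemma demands_cons_neq E v u p q : u != v -> u != free_letter_inv v ->
  demands ((v, (p, q)) :: E) u = demands E u.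
Proof.
rewrite /demands /= => /negbTE uv /negbTE uv'.
rewrite eq_sym uv -[v in v == _](@free_letter_invK _ v).
by rewrite (can_eq (@free_letter_invK _)) eq_sym uv'.
Qed.

Definition consistent E := forall v, partial_iso lt1 lt2 (demands E v).

(** The inverse letter receives the reversed pairs, which again form a partial isomorphism, and the
    demands on other letters do not change. *)
Lemma consistent_cons E v p q : consistent E ->
  partial_iso lt1 lt2 ((p, q) :: demands E v) ->
  consistent ((v, (p, q)) :: E).
Proof.
move=> cE iso u; case: (eqVneq u v) => [->|uv]; first by rewrite demands_cons.
case: (eqVneq u (free_letter_inv v)) => [->|uv']; last first.
  by rewrite demands_cons_neq.
move=> [a b] [a' b']; rewrite !demands_inv demands_cons => ba b'a'.
by have [/= -> ->] := iso _ _ ba b'a'.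
Qed.

Lemma consistent_realized E : consistent E -> exists g : 'I_r -> aut,
  forall v a b, (a, b) \in demands E v -> free_letter_val g v a = b.
Proof.
move=> cE; have [g gE] := choice (fun i : 'I_r => partial_iso_extends hP (cE (i, false))).
exists g => -[i []] a b ab; last exact: (gE i _ ab).
have := gE i (b, a); rewrite -demands_inv => /(_ ab) /= <-.
exact: aut_funK.
Qed.

(* The trajectory of p is built one letter at a time: each letter sends the
   current point to a fresh one, which the next constant, when nontrivial, moves;
   so the next letter of a reduced word is not yet determined at the new point. *)
Lemma follow_word (l : seq (sgn * aut)) E (t : seq P) p :
  reduced l -> consistent E ->
  (if l is a :: _ then p \notin map fst (demands E a.1) else p \notin t) ->
  exists2 g : 'I_r -> aut,
    forall v a b, (a, b) \in demands E v -> free_letter_val g v a = b &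
    word_eval g (syllables_word l) p \notin t.
Proof.
elim: l E p => [|[v c] l IH] E p redl cE fresh.
  have [g gE] := consistent_realized cE; exists g => //.
  by rewrite (word_eval_morphism g).1.
(* All points met so far: outside [used], no letter has a demand coming from [E]. *)
pose used := p :: t ++ map (fun e => e.2.1) E ++ map (fun e => e.2.2) E.
have [q [qu cqu cq iso]] := partial_iso_step hP c used (cE v) fresh.
have notin_dom x u : x \notin used -> x \notin map fst (demands E u).
  apply: contra => /mapP[[a b] + ->].
  rewrite mem_demands inE !mem_cat => /orP[/(map_f (fun e => e.2.1))|].
    by move=> ->; rewrite !orbT.
  by move=> /(map_f (fun e => e.2.2)) ->; rewrite !orbT.
have cE' := consistent_cons cE iso.
have [||g gE gl] := IH _ (c q) _ cE'; first exact: path_sorted redl.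
  case: l redl {IH} => [_|[u d] l /= /andP[uvc _]].
    by move: cqu; rewrite inE mem_cat !negb_or => /and3P[].
  apply/mapP => -[[a b] + /= cqa]; rewrite -{}cqa.
  have dom u' : (c q, b) \in demands E u' -> False.
    by move=> /(map_f fst); apply/negP; exact: notin_dom.
  have [->|uv] := eqVneq u v.
    rewrite demands_cons inE => /orP[/eqP[cqp _]|/dom //].
    by move: cqu; rewrite cqp mem_head.
  (* The inverse of [v] is now determined at [q]; in this case reducedness gives [c != 1], so [c q]
     differs from [q]. *)
  move: uvc; have [-> /= c1|uv' _] := eqVneq u (free_letter_inv v).
    rewrite demands_cons_inv => /orP[/eqP[cqq _]|/dom //].
    by move: (cq c1); rewrite cqq eqxx.
  by rewrite demands_cons_neq // => /dom.
exists g.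
  move=> u a b ab; apply: gE; move: ab; rewrite !mem_demands !inE.
  by case/orP=> ->; rewrite !orbT.
rewrite word_eval_syllables /=.
suff -> : free_letter_val g v p = q by [].
by apply: gE; rewrite demands_cons mem_head.
Qed.

End FollowWord.

Theorem corollary4p4p3 (P : countType) (lt1 lt2 : rel P)
    (hP : random_permutation lt1 lt2) (r : nat) :
  ~ exists w : const_word (two_order_aut lt1 lt2) r, mixed_identity w.
Proof.
move=> [w [w1 wid]]; have [l [c [redl wE]]] := reduced_form w.
case: l => [|a l] in redl wE.
  have := wid (fun=> 1); rewrite wE mul1g word_eval_const => c1.
  by apply: w1; rewrite wE c1 free_inl1 mulg1.
(* Cuts of the empty set: this only provides a point of [P]. *)
have [p _] := rp_realizes_cuts hP [::] (D1 := pred0) (D2 := pred0)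
  (fun _ _ _ => id) (fun _ _ _ => id).
(* The trailing constant [c] acts first, so the trajectory starts at [c p]; it must not end at
   [p]. *)
have [//|//|g _] := @follow_word _ _ _ _ hP (a :: l) [::] [:: p] (c p) redl.
have := congr1 (fun h : two_order_aut lt1 lt2 => h p) (wid g).
by rewrite wE word_evalM word_eval_const /= => ->; rewrite mem_head.
Qed.
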